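(* Let $K$ be a field and let $F(x)\in K[x]$ be a polynomial of degree $3n$. We have $(x-1)^{3n}\cdot F\bigl(1/(1-x)\bigr)=F(x)$ if, and only if, \[ F(x)=x^n(x-1)^n\cdot f\left(\frac{x^3-3x+1}{x(x-1)}\right) \] for some $f\in K[x]$ of degree $n$.
   Context: Here $n$ is a non-negative integer, and the identities are in the field $K(x)$ of rational functions. *)

(* Defs.v *)
From mathcomp Require Import all_boot all_order all_algebra.
Set Implicit Arguments.
Unset Strict Implicit.
Unset Printing Implicit Defensive.
Import GRing.Theory.
Local Open Scope ring_scope.

Notation ratfun K := {fraction {poly K}}.

Definition ratX (K : fieldType) : ratfun K := FracField.tofrac 'X.

Definition ratC (K : fieldType) (c : K) : ratfun K := FracField.tofrac c%:P.

(* p(u) for p in K[x] and a rational function u in K(x). *)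
Definition subst_ratfun (K : fieldType) (p : {poly K}) (u : ratfun K) :
  ratfun K := (map_poly (@ratC K) p).[u].

(* Main.v *)
Require Import Defs.
From mathcomp Require Import all_boot all_order all_algebra.
From mathcomp Require Import ring.
Import GRing.Theory.
Set Implicit Arguments.
Unset Strict Implicit.
Local Open Scope ring_scope.

(** The order-three map [T : x |-> 1 / (1 - x)] acts on polynomials of degree at
    most [m] by [P |-> (x - 1)^m P(T x)], sending them to polynomials again.
    Write [p = x^3 - 3x + 1] and [q = x (x - 1)]. Since [p(T x) = p / (x - 1)^3]
    and [q(T x) = q / (x - 1)^3], the quotient [p / q] is unchanged by [T], and
    [q^n f(p / q)] is fixed by the action with [m = 3n] for every [f].

    Conversely, let [F] of degree at most [3n] be fixed. As [p] is monic of
    degree 3, subtracting [c p^n], where [c] is the coefficient of [x^(3n)],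
    leaves a fixed [G] of degree less than [3n]. The missing top coefficient
    forces [G(1) = 0], because [T 1] is the point at infinity; and [G(0) = 0]
    follows, because [T 0 = 1]. Hence [G = q G'], where [G'] has degree at most
    [3(n - 1)] and is again fixed, now with [m = 3(n - 1)]. Induction on [n]
    gives [F = c p^n + q q^(n-1) f'(p / q) = q^n f(p / q)] with
    [f = c X^n + f'] and [deg f' < n]. So the coefficient of [X^n] in [f] is
    that of [x^(3n)] in [F], which makes [deg f = n] when [deg F = 3n]. *)

(** * Identities in a field *)

(** An abstract field in place of [K(x)] keeps normalisation of these
    identities from unfolding fractions into classes of pairs of polynomials. *)
Section FieldIdentities.

Variable L : fieldType.
Implicit Types a b c h y : L.

Lemma cubic_orbit y : 1 - y != 0 ->
  (y - 1) ^+ 3 * ((1 / (1 - y)) ^+ 3 - (1 / (1 - y)) *+ 3 + 1)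
    = y ^+ 3 - y *+ 3 + 1.
Proof. by move=> y1; field. Qed.

Lemma quadratic_orbit y : 1 - y != 0 ->
  (y - 1) ^+ 3 * (1 / (1 - y) * (1 / (1 - y) - 1)) = y * (y - 1).
Proof. by move=> y1; field. Qed.

Lemma orbit_sub1 y h m : 1 - y != 0 ->
  (y - 1) ^+ m.+2 * ((1 / (1 - y) - 1) * h)
    = (y - 1) * - (y * ((y - 1) ^+ m * h)).
Proof. by move=> y1; rewrite !exprS; field. Qed.

Lemma orbitE y : 1 - y != 0 -> 1 / (1 - y) = - 1 / (y - 1).
Proof. by move=> _; rewrite mulNr -mulrN -invrN opprB. Qed.

(** One step of the Horner scheme for a polynomial at [a / b], multiplied
    through by the power of [b] that its degree requires. *)
Lemma horner_step_homog a b c h m : b != 0 ->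
  b ^+ m.+1 * (h * (a / b) + c) = c * b ^+ m.+1 + a * (b ^+ m * h).
Proof. by move=> b0; rewrite exprS; field. Qed.

Lemma cubic_quotient y : y != 0 -> y - 1 != 0 ->
  y ^+ 3 - y *+ 3 + 1
    = y * (y - 1) * ((y ^+ 3 - 3%:R * y + 1) / (y * (y - 1))).
Proof. by move=> y0 y1; rewrite [RHS]mulrC divfK ?mulf_neq0 // mulr_natl. Qed.

Lemma expansion_step a b c h y n :
  c * (a * b * y) ^+ n.+1 + a * b * (a ^+ n * b ^+ n * h)
    = a ^+ n.+1 * b ^+ n.+1 * (c * y ^+ n.+1 + h).
Proof. by rewrite !exprMn !exprS; ring. Qed.

End FieldIdentities.

(** * Substitution as a ring morphism *)

Section Substitution.

Variable K : fieldType.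
Implicit Types (p r : {poly K}) (u : ratfun K) (c : K).

Let ratC_morph : {rmorphism K -> ratfun K} :=
  (@FracField.tofrac {poly K} \o polyC)%FUN.
Let subst_morph u : {rmorphism {poly K} -> ratfun K} :=
  (horner_eval u \o map_poly ratC_morph)%FUN.

Lemma substD p r u :
  subst_ratfun (p + r) u = subst_ratfun p u + subst_ratfun r u.
Proof. exact: (rmorphD (subst_morph u)). Qed.

Lemma substN p u : subst_ratfun (- p) u = - subst_ratfun p u.
Proof. exact: (rmorphN (subst_morph u)). Qed.

Lemma substM p r u :
  subst_ratfun (p * r) u = subst_ratfun p u * subst_ratfun r u.
Proof. exact: (rmorphM (subst_morph u)). Qed.

Lemma substXn p u n : subst_ratfun (p ^+ n) u = subst_ratfun p u ^+ n.
Proof. exact: (rmorphXn (subst_morph u)). Qed.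

Lemma substMn p u n : subst_ratfun (p *+ n) u = subst_ratfun p u *+ n.
Proof. exact: (rmorphMn (subst_morph u)). Qed.

Lemma subst0 u : subst_ratfun 0 u = 0.
Proof. exact: (rmorph0 (subst_morph u)). Qed.

Lemma subst1 u : subst_ratfun 1 u = 1.
Proof. exact: (rmorph1 (subst_morph u)). Qed.

Lemma substX u : subst_ratfun 'X u = u.
Proof. by rewrite /subst_ratfun (map_polyX ratC_morph) hornerX. Qed.

Lemma substC c u : subst_ratfun c%:P u = ratC c.
Proof. by rewrite /subst_ratfun (map_polyC ratC_morph) hornerC. Qed.

Definition substE :=
  (substD, substN, substM, substXn, substMn, subst0, subst1, substX, substC).

Lemma subst_ratX p : subst_ratfun p (ratX K) = FracField.tofrac p.
Proof.
elim/poly_ind: p => [|p c IHp]; first by rewrite subst0 rmorph0.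
by rewrite !substE IHp rmorphD rmorphM.
Qed.

Lemma subst_ratX_inj p r :
  subst_ratfun p (ratX K) = subst_ratfun r (ratX K) -> p = r.
Proof. by rewrite !subst_ratX => /eqP; rewrite tofrac_eq => /eqP. Qed.

Lemma ratX_neq0 : ratX K != 0.
Proof. by rewrite tofrac_eq0 polyX_eq0. Qed.

Lemma ratX_sub1_neq0 : ratX K - 1 != 0.
Proof. by rewrite -tofrac1 -tofracB tofrac_eq0 -polyC1 polyXsubC_eq0. Qed.

End Substitution.

(** * The action of x |-> 1 / (1 - x) *)

Section Action.

Variable K : fieldType.
Implicit Types (P F G f : {poly K}) (m n : nat).

Local Notation x := (ratX K).
Local Notation T := (1 / (1 - x)).

Definition cubic : {poly K} := 'X^3 - 'X *+ 3 + 1.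
Definition quadratic : {poly K} := 'X * ('X - 1).
Local Notation w := ((x ^+ 3 - 3%:R * x + 1) / (x * (x - 1))).

Let x_neq0 : x != 0 := ratX_neq0 K.
Let x1_neq0 : x - 1 != 0 := ratX_sub1_neq0 K.
Let onex_neq0 : 1 - x != 0.
Proof. by rewrite -oppr_eq0 opprB. Qed.

(** The weight [m] may exceed the degree of [P]: it is the weight, as in the
    action on binary forms of degree [m], that adds up in products. *)
Definition fixed m P :=
  (x - 1) ^+ m * subst_ratfun P T = subst_ratfun P x.

Lemma fixed_cubic : fixed 3 cubic.
Proof. by rewrite /fixed /cubic !substE (cubic_orbit onex_neq0). Qed.

Lemma fixed_quadratic : fixed 3 quadratic.
Proof. by rewrite /fixed /quadratic !substE (quadratic_orbit onex_neq0). Qed.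

Lemma fixedX m n P : fixed m P -> fixed (m * n) (P ^+ n).
Proof. by rewrite /fixed !substXn exprM -exprMn => ->. Qed.

Lemma fixedBZ m P G c : fixed m P -> fixed m G -> fixed m (P - c%:P * G).
Proof. by rewrite /fixed !substE => <- <-; rewrite mulrBr (mulrCA _ (ratC c)). Qed.

Lemma fixedM_cancel m n P G :
  P != 0 -> fixed m P -> fixed (m + n) (P * G) -> fixed n G.
Proof.
move=> P0 fixP; rewrite /fixed !substM exprD mulrACA fixP.
by apply: mulfI; rewrite subst_ratX tofrac_eq0.
Qed.

(** Each monomial of [P] of degree [i <= m] contributes a multiple of
    [A^i B^(m - i)], so [H] is the homogenisation of [P] of degree [m] at
    [(A, B)]. The identity at several points [u] with the same [H] is what lets
    an equation in [x] be transported to [T]. *)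
Lemma clear_denominators m P A B : (size P <= m.+1)%N ->
  exists H : {poly K}, forall u, subst_ratfun B u != 0 ->
    subst_ratfun B u ^+ m * subst_ratfun P (subst_ratfun A u / subst_ratfun B u)
      = subst_ratfun H u.
Proof.
elim/poly_ind: P m => [|P c IHP] m.
  by exists 0 => u _; rewrite !subst0 mulr0.
rewrite size_MXaddC; case: ifP => [/andP[/eqP-> /eqP->] _|_].
  by exists 0 => u _; rewrite mul0r add0r polyC0 !subst0 mulr0.
rewrite ltnS; case: m => [|m szP].
  rewrite leqn0 size_poly_eq0 => /eqP->; exists c%:P => u _.
  by rewrite !substE expr0 mul1r mul0r add0r.
have [H defH] := IHP m szP.
exists (c%:P * B ^+ m.+1 + A * H) => u Bu0; rewrite !substE -defH //.
exact: horner_step_homog.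
Qed.

Lemma clear_denominators_T m P : (size P <= m.+1)%N ->
  exists H : {poly K}, (x - 1) ^+ m * subst_ratfun P T = subst_ratfun H x.
Proof.
move=> szP; have [H defH] := clear_denominators (-1) ('X - 1) szP.
have x1 : subst_ratfun ('X - 1) x != 0 by rewrite !substE x1_neq0.
by exists H; rewrite (orbitE onex_neq0) -(defH _ x1) !substE.
Qed.

(** [T 1] is infinite and [T 0 = 1], so a fixed polynomial whose degree falls
    short of the weight vanishes at 1, and then at 0. *)
Lemma quadratic_dvd_fixed m G : (size G <= m.+2)%N -> fixed m.+2 G ->
  exists G', G = quadratic * G'.
Proof.
move=> szG fixG; have [H defH] := clear_denominators_T szG.
have GE : G = ('X - 1) * H.
  by apply: subst_ratX_inj; rewrite -fixG !substE -defH exprS mulrA.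
have szH : (size H <= m.+1)%N.
  have [->|H0] := eqVneq H 0; first by rewrite size_poly0.
  move: szG; rewrite GE -polyC1 size_mul ?polyXsubC_eq0 //.
  by rewrite size_XsubC.
have [H' defH'] := clear_denominators_T szH.
(* Both sides of the fixed-point equation now carry a factor [x - 1], since
   [T - 1 = - x / (x - 1)]; cancelling it shows that [H] is a multiple of [x]. *)
have HE : H = - ('X * H').
  apply: subst_ratX_inj; apply: (mulfI x1_neq0).
  transitivity (subst_ratfun G x); first by rewrite GE !substE.
  by rewrite -fixG GE !substE -defH' (orbit_sub1 _ _ onex_neq0).
by exists (- H'); rewrite GE HE /quadratic -mulrN mulrCA mulrA.
Qed.

Lemma cubicE : cubic = 'X^3 + ((- 3%:R)%:P * 'X + 1%:P).
Proof. by rewrite /cubic polyCN polyC1 polyC_natr; ring. Qed.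

Lemma size_cubic_tail : (size ((- 3%:R)%:P * 'X + 1%:P : {poly K})%R < 4)%N.
Proof.
rewrite size_MXaddC oner_eq0 andbF size_polyC.
by case: (_ != _).
Qed.

Lemma size_cubic : size cubic = 4.
Proof. by rewrite cubicE size_polyDl size_polyXn ?size_cubic_tail. Qed.

Lemma cubic_monic : cubic \is monic.
Proof.
by rewrite cubicE monicE lead_coefDl ?lead_coefXn // size_polyXn size_cubic_tail.
Qed.

Lemma size_quadraticM G : G != 0 -> size (quadratic * G) = (size G).+2.
Proof.
move=> G0; rewrite -mulrA mulrC size_mulX; last first.
  by rewrite mulf_neq0 // -polyC1 polyXsubC_eq0.
by rewrite -polyC1 size_mul ?polyXsubC_eq0 // size_XsubC.
Qed.

Lemma quadratic_neq0 : quadratic != 0.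
Proof. by rewrite mulf_neq0 ?polyX_eq0 // -polyC1 polyXsubC_eq0. Qed.

(** This is the expansion of [F] as a combination of the [p^i q^(n - i)], for
    [p] the cubic and [q] the quadratic: the monic [p^n] absorbs the top
    coefficient of [F], and [q] divides what is left. The coefficient of index
    [n] is recorded because it decides the degree of [f]. *)
Lemma fixed_expansion n F : (size F <= (3 * n).+1)%N -> fixed (3 * n) F ->
  exists f, [/\ (size f <= n.+1)%N, f`_n = F`_(3 * n)
    & subst_ratfun F x = x ^+ n * (x - 1) ^+ n * subst_ratfun f w].
Proof.
elim: n F => [|n IHn] F szF fixF.
  by exists F; split=> //; rewrite (size1_polyC szF) !substE !expr0 !mul1r.
set c := F`_(3 * n.+1).
have size_cn : size (cubic ^+ n.+1) = (3 * n.+1).+1.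
  have := size_exp cubic n.+1; rewrite size_cubic /= => <-.
  by rewrite prednK // size_poly_gt0 monic_neq0 ?monic_exp ?cubic_monic.
pose G := F - c%:P * cubic ^+ n.+1.
have fixG : fixed (3 * n.+1) G by apply/fixedBZ/fixedX/fixed_cubic.
have szG : (size G <= 3 * n.+1)%N.
  apply/leq_sizeP => j; rewrite leq_eqVlt coefB coefCM => /predU1P[<-|ltj].
    have /monicP := monic_exp n.+1 cubic_monic.
    by rewrite /lead_coef size_cn /= => ->; rewrite mulr1 subrr.
  by rewrite !nth_default ?size_cn ?mulr0 ?subr0 // (leq_trans szF).
move: fixG szG; rewrite mulnS => fixG szG.
have [G' defG] := quadratic_dvd_fixed szG fixG.
have szG' : (size G' <= (3 * n).+1)%N.
  have [->|G'0] := eqVneq G' 0; first by rewrite size_poly0.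
  by move: szG; rewrite defG size_quadraticM.
have fixG' : fixed (3 * n) G'.
  by apply: fixedM_cancel quadratic_neq0 fixed_quadratic _; rewrite -defG.
have [f' [szf' _ G'E]] := IHn G' szG' fixG'.
exists (c%:P * 'X^(n.+1) + f'); split.
- rewrite (leq_trans (size_polyD _ _)) // geq_max (leq_trans szf') // andbT.
  by rewrite mul_polyC (leq_trans (size_scale_leq _ _)) ?size_polyXn.
- by rewrite coefD coefCM coefXn eqxx mulr1 [f'`__]nth_default ?addr0.
have -> : F = c%:P * cubic ^+ n.+1 + quadratic * G' by rewrite -defG addrC subrK.
have px : subst_ratfun cubic x = x * (x - 1) * w.
  rewrite /cubic !substE; exact: (cubic_quotient x_neq0 x1_neq0).
have qx : subst_ratfun quadratic x = x * (x - 1) by rewrite /quadratic !substE.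
rewrite substD (substM c%:P) substXn (substM quadratic) px qx G'E !substE.
exact: expansion_step.
Qed.

(** With denominators cleared, the right-hand side is a polynomial in [x], so
    the equation also holds at [T]. There the argument of [f] has the same value
    [w], and the quadratic is divided by [(x - 1)^3]. *)
Lemma fixed_of_expansion n F f : (size f <= n.+1)%N ->
  subst_ratfun F x = x ^+ n * (x - 1) ^+ n * subst_ratfun f w ->
  fixed (3 * n) F.
Proof.
move=> szf FE.
have [H defH] := clear_denominators cubic quadratic szf.
have qx0 : subst_ratfun quadratic x != 0.
  by rewrite subst_ratX tofrac_eq0 quadratic_neq0.
have pT : (x - 1) ^+ 3 * subst_ratfun cubic T = subst_ratfun cubic x.
  exact: fixed_cubic.
have qT : (x - 1) ^+ 3 * subst_ratfun quadratic T = subst_ratfun quadratic x.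
  exact: fixed_quadratic.
have qT0 : subst_ratfun quadratic T != 0.
  by apply: contraNneq qx0 => qT0; rewrite -qT qT0 mulr0.
have px : subst_ratfun cubic x = x ^+ 3 - 3%:R * x + 1.
  by rewrite /cubic !substE mulr_natl.
have qx : subst_ratfun quadratic x = x * (x - 1) by rewrite /quadratic !substE.
have FH : F = H.
  by apply: subst_ratX_inj; rewrite FE -exprMn -(defH _ qx0) px qx.
have pqT : subst_ratfun cubic T / subst_ratfun quadratic T
    = subst_ratfun cubic x / subst_ratfun quadratic x.
  by rewrite -qT -pT -[RHS]mulf_div (divff (expf_neq0 3 x1_neq0)) [RHS]mul1r.
by rewrite /fixed FH -(defH _ qx0) -(defH _ qT0) mulrA exprM -exprMn qT pqT.
Qed.

End Action.

Theorem lemma11 (K : fieldType) (n : nat) (F : {poly K})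
    (hF : size F = (3 * n).+1) :
  let x := ratX K in
  (x - 1) ^+ (3 * n) * subst_ratfun F (1 / (1 - x)) = subst_ratfun F x
  <->
  exists f : {poly K},
    size f = n.+1 /\
    subst_ratfun F x =
      x ^+ n * (x - 1) ^+ n *
      subst_ratfun f ((x ^+ 3 - 3%:R * x + 1) / (x * (x - 1))).
Proof.
move=> x; split=> [fixF | [f [szf FE]]].
  have [f [szf fn FE]] := fixed_expansion (n:=n) (eq_leq hF) fixF.
  exists f; split=> //; apply/eqP; rewrite eqn_leq szf ltnNge; apply/negP.
  (* A smaller degree would make the coefficient of index [n] vanish, and that is
     the leading coefficient of [F]. *)
  move=> /leq_sizeP/(_ n (leqnn n))/eqP; rewrite fn.
  have := lead_coef_eq0 F; rewrite /lead_coef hF /= => ->.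
  by rewrite -size_poly_eq0 hF.
by apply: fixed_of_expansion FE; rewrite szf.
Qed.
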